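(* Let $N\ge 2$ be an integer. There does not exist a generalized Metropolis procedure $\mathcal{C}\ni U\mapsto P_U$ on $\{0,1,\dots,N\}$ such that $P_U$ satisfies the hypergroup property for all $U\in\mathcal{C}$.
   Context: Let $V$ be a finite set. A Markov kernel on $V$ is a matrix $(P(x,y))_{x,y\in V}$ with non-negative entries and row sums equal to 1. It is irreducible if all entries of $\sum_{n=1}^{|V|}P^n$ are positive. It is reversible if there is a probability measure $\mu$, positive at every point of $V$, with $\mu(x)P(x,y)=\mu(y)P(y,x)$ for all $x,y$; then there are orthonormal bases $\varphi_1,\dots,\varphi_{|V|}$ of $\mathbb{L}^2(\mu)$ consisting of eigenvectors of $P$ (associated to the eigenvalues $1=\theta_1\ge\theta_2\ge\cdots\ge\theta_{|V|}\ge-1$), always chosen with $\varphi_1=1$ (the constant function). A reversible $P$ satisfies the hypergroup property with respect to a point $x_0\in V$ if such a basis can be chosen with $\varphi_k(x_0)\neq0$ for all $k$ and $\sum_{k=1}^{|V|}\frac{\varphi_k(x)\varphi_k(y)\varphi_k(z)}{\varphi_k(x_0)}\ge0$ for all $x,y,z\in V$. $P$ satisfies the hypergroup property if it does so with respect to some $x_0\in V$. $\mathcal{C}$ is the set of functions $U:\{0,\dots,N\}\to\mathbb{R}$ that are convex (i.e. whose piecewise affine extension to $[0,N]$ is convex), with the topology inherited from $\mathbb{R}^{N+1}$. For $U\in\mathcal{C}$, $\mu_U$ is the probability on $\{0,\dots,N\}$ given by $\mu_U(x)=Z_U^{-1}e^{-U(x)}$, with $Z_U$ the normalizing constant. A Markov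 kernel $P$ on $\{0,\dots,N\}$ is birth and death if $P(x,y)>0$ implies $|x-y|\le1$ (an irreducible birth and death kernel is automatically reversible with respect to its invariant probability). A (birth and death) generalized Metropolis procedure is a continuous map $\mathcal{C}\ni U\mapsto P_U$ (Markov kernels being given the topology of real matrices) such that for every $U\in\mathcal{C}$, $P_U$ is an irreducible birth and death Markov kernel on $\{0,\dots,N\}$ whose invariant probability is $\mu_U$. *)

(* Defs.v *)
From HB Require Import structures.
From mathcomp Require Export all_boot all_order all_algebra.
From mathcomp Require Export all_classical all_reals all_analysis.

Set Implicit Arguments.
Unset Strict Implicit.
Unset Printing Implicit Defensive.

Import Order.TTheory GRing.Theory Num.Theory.
Import numFieldNormedType.Exports.

Local Open Scope classical_set_scope.
Local Open Scope ring_scope.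

Section FiniteKernels.
Variables (R : realType) (n : nat).

(* The finite set V is 'I_n.+1, so #|V| = n.+1. *)
Implicit Types (P : 'M[R]_n.+1) (mu : 'rV[R]_n.+1) (x y z j k : 'I_n.+1).

Definition markov_kernel P : Prop :=
  (forall x y, 0 <= P x y) /\ (forall x, \sum_y P x y = 1).

Definition irreducible_kernel P : Prop :=
  forall x y, 0 < (\sum_(1 <= i < n.+2) P ^+ i) x y.

(* Probabilities on V are given by their weights, as row vectors. *)
Definition probability_weights mu : Prop :=
  (forall x, 0 <= mu ord0 x) /\ \sum_x mu ord0 x = 1.

Definition invariant_probability mu P : Prop :=
  probability_weights mu /\ mu *m P = mu.

Definition reversible_wrt mu P : Prop :=
  [/\ probability_weights mu, forall x, 0 < mu ord0 x &
      forall x y, mu ord0 x * P x y = mu ord0 y * P y x].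

Definition L2_dot mu (f g : 'cV[R]_n.+1) : R :=
  \sum_x mu ord0 x * (f x ord0 * g x ord0).

(* The index k : 'I_n.+1 is shifted by one: [phi ord0] is the first vector.
   The family being orthonormal with #|V| members, it is a basis of L^2(mu). *)
Definition orthonormal_eigenbasis mu P
    (theta : 'I_n.+1 -> R) (phi : 'I_n.+1 -> 'cV[R]_n.+1) : Prop :=
  [/\ forall j k, L2_dot mu (phi j) (phi k) = (j == k)%:R,
      forall k, P *m phi k = theta k *: phi k,
      [/\ theta ord0 = 1,
          forall j k, (j <= k)%N -> theta k <= theta j &
          forall k, -1 <= theta k] &
      phi ord0 = const_mx 1].

Definition hypergroup_property_at P (x0 : 'I_n.+1) : Prop :=
  exists mu, reversible_wrt mu P /\
  exists theta phi,
    [/\ orthonormal_eigenbasis mu P theta phi,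
        forall k, phi k x0 ord0 != 0 &
        forall x y z,
          0 <= \sum_k (phi k x ord0 * phi k y ord0 * phi k z ord0)
                      / phi k x0 ord0].

Definition hypergroup_property P : Prop :=
  exists x0, hypergroup_property_at P x0.

Definition birth_death P : Prop :=
  forall x y, 0 < P x y -> (`|x - y| <= 1)%N.

End FiniteKernels.

Section Metropolis.
Variables (R : realType) (N : nat).

(* A function U : {0, ..., N} -> R is a row vector, x |-> U ord0 x; the topology
   on 'rV[R]_N.+1 and on 'M[R]_N.+1 is the usual entrywise one. *)
Implicit Types U : 'rV[R]_N.+1.

(* Meaningful for 0 <= t <= N. At t = N the second term has coefficient 0, so
   the default value of [inord N.+1] plays no role. *)
Definition affine_extension U (t : R) : R :=
  let i := Num.truncn t in
  (1 - (t - i%:R)) * U ord0 (inord i) + (t - i%:R) * U ord0 (inord i.+1).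

Definition convex_potentials : set 'rV[R]_N.+1 :=
  [set U | convex_function (`[0, N%:R]%classic : set R) (affine_extension U)].

Definition partition_function U : R := \sum_x expR (- U ord0 x).

Definition gibbs U : 'rV[R]_N.+1 :=
  \row_x ((partition_function U)^-1 * expR (- U ord0 x)).

(* The values of P outside [convex_potentials] are irrelevant: continuity is for
   the topology induced on that set. *)
Definition generalized_metropolis (P : 'rV[R]_N.+1 -> 'M[R]_N.+1) : Prop :=
  {within convex_potentials, continuous P} /\
  (forall U, U \in convex_potentials ->
     [/\ markov_kernel (P U), irreducible_kernel (P U), birth_death (P U) &
         invariant_probability (gibbs U) (P U)]).

End Metropolis.

(* Main.v *)
Require Import Defs.
From mathcomp Require Import all_boot all_order all_algebra.
From mathcomp Require Import all_classical all_reals all_analysis.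
From mathcomp Require Import zify ring.
Import Order.TTheory GRing.Theory Num.Theory.
Local Open Scope classical_set_scope.
Local Open Scope ring_scope.

(** The constant potential already rules out the hypergroup property. Let [P]
    be reversible with respect to the uniform probability [mu] and have the
    hypergroup property at [x0]. For each [x],
    [w z = mu z * \sum_k phi_k x ^+ 2 * phi_k z / phi_k x0] is a probability
    with [w x0 = mu x0 / mu x = 1], hence a Dirac mass at [x0]; integrating
    [phi_k] against it gives [phi_k x ^+ 2 = phi_k x0 ^+ 2]. Therefore
    [P x x = mu x * \sum_k theta_k * phi_k x ^+ 2] does not depend on [x]. If
    moreover [P] is birth and death, the rows [0] and [1] give [P 0 1 = 1 - d]
    and [P 1 0 + P 1 2 = 1 - d], where [d] is the common diagonal entry, so
    [P 1 2 = 0] by symmetry, which contradicts irreducibility. *)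

(** Serves twice: for harmonic functions, and for the indicator of a set that no edge of [P] leaves
    or enters. *)
Lemma irreducible_edge_constant {R : realType} {n : nat} {P : 'M[R]_n.+1}
    {f : 'I_n.+1 -> R} :
  (forall x y, 0 <= P x y) -> irreducible_kernel P ->
  (forall x y, 0 < P x y -> f x = f y) -> forall x y, f x = f y.
Proof.
move=> P0 irrP fP x y.
(* Constancy of [f] along the edges of [P] means that [diag f] commutes with
   [P], hence with the positive matrix [\sum_i P ^+ i]. *)
pose D : 'M[R]_n.+1 := diag_mx (\row_i f i).
have comDP : GRing.comm D P.
  rewrite /GRing.comm -!mulmxE mul_diag_mx mul_mx_diag.
  apply/matrixP => i j; rewrite !mxE.
  have [Pij|] := ltP 0 (P i j); first by rewrite (fP _ _ Pij) mulrC.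
  move=> Pij; have -> : P i j = 0 by apply/le_anti; rewrite Pij P0.
  by rewrite mulr0 mul0r.
have : GRing.comm D (\sum_(1 <= i < n.+2) P ^+ i).
  by apply: commr_sum => i _; exact: commrX.
rewrite /GRing.comm -!mulmxE mul_diag_mx mul_mx_diag => /matrixP /(_ x y).
rewrite [LHS]mxE [RHS]mxE !mxE mulrC => /mulfI; apply.
by rewrite gt_eqF ?irrP.
Qed.

Lemma reversible_harmonic_constant {R : realType} {n : nat} {P : 'M[R]_n.+1}
    {mu : 'rV[R]_n.+1} {g : 'cV[R]_n.+1} :
  markov_kernel P -> irreducible_kernel P -> reversible_wrt mu P ->
  P *m g = g -> forall x y, g x ord0 = g y ord0.
Proof.
move=> [P0 P1] irrP [_ mu0 rev] Pg.
have Pgx x : \sum_y P x y * g y ord0 = g x ord0.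
  by rewrite -{2}Pg mxE.
(* the Dirichlet form of [g] vanishes *)
have E0 : \sum_x \sum_y mu ord0 x * P x y * (g x ord0 - g y ord0) ^+ 2 = 0.
  (* Expanding the square gives three sums, all equal to the squared norm of [g]: [sq1] by the row
     sums, [sq2] by reversibility, [cross] by [P *m g = g]. *)
  have sq1 : \sum_x \sum_y mu ord0 x * P x y * g x ord0 ^+ 2
             = \sum_x mu ord0 x * g x ord0 ^+ 2.
    by apply: eq_bigr => x _; rewrite -mulr_suml -mulr_sumr P1 mulr1.
  have sq2 : \sum_x \sum_y mu ord0 x * P x y * g y ord0 ^+ 2
             = \sum_x mu ord0 x * g x ord0 ^+ 2.
    rewrite exchange_big -sq1; apply: eq_bigr => y _; apply: eq_bigr => x _.
    by rewrite rev.
  have cross : \sum_x \sum_y mu ord0 x * P x y * (g x ord0 * g y ord0)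
             = \sum_x mu ord0 x * g x ord0 ^+ 2.
    apply: eq_bigr => x _; rewrite expr2 -{3}Pgx !mulr_sumr.
    by apply: eq_bigr => y _; ring.
  transitivity (\sum_x \sum_y (mu ord0 x * P x y * g x ord0 ^+ 2
    + mu ord0 x * P x y * g y ord0 ^+ 2
    - mu ord0 x * P x y * (g x ord0 * g y ord0) *+ 2)).
    by apply: eq_bigr => x _; apply: eq_bigr => y _; ring.
  under eq_bigr => x _ do rewrite sumrB big_split /= sumrMnl.
  by rewrite sumrB big_split /= sumrMnl sq1 sq2 cross -mulr2n subrr.
have t0 x y : 0 <= mu ord0 x * P x y * (g x ord0 - g y ord0) ^+ 2.
  by rewrite mulr_ge0 ?sqr_ge0 // mulr_ge0 // ltW.
apply: (irreducible_edge_constant P0 irrP (f := fun x => g x ord0)) => x y Pxy.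
have E0x : \sum_y mu ord0 x * P x y * (g x ord0 - g y ord0) ^+ 2 = 0.
  apply: (psumr_eq0P _ E0) => // z _; exact: sumr_ge0.
have /eqP := psumr_eq0P (fun y _ => t0 x y) E0x (i := y) isT.
rewrite mulf_eq0 sqrf_eq0 mulf_eq0 (gt_eqF Pxy) (gt_eqF (mu0 x)).
by rewrite subr_eq0 => /eqP.
Qed.

(** By reversibility the density of [nu] with respect to [mu] is harmonic, hence constant; equal
    total masses force the constant to be 1. *)
Lemma reversible_invariant_unique {R : realType} {n : nat} {P : 'M[R]_n.+1}
    {mu nu : 'rV[R]_n.+1} :
  markov_kernel P -> irreducible_kernel P -> reversible_wrt mu P ->
  invariant_probability nu P -> nu = mu.
Proof.
move=> mP irrP revP [[_ nu1] nuP].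
have [[_ mu1] mu0 rev] := revP.
have muN0 x : mu ord0 x != 0 by rewrite gt_eqF.
pose g : 'cV[R]_n.+1 := \col_x (nu ord0 x / mu ord0 x).
have Pg : P *m g = g.
  apply/matrixP => x j; rewrite !mxE -{1}nuP mxE mulr_suml.
  apply: eq_bigr => y _; rewrite mxE.
  apply: (mulfI (muN0 x)); apply: (mulfI (muN0 y)).
  have := rev x y; have := muN0 x; have := muN0 y.
  move=> hy hx hxy.
  transitivity (mu ord0 x * P x y * nu ord0 y); first by field.
  by rewrite hxy; field; rewrite hx.
have gC := reversible_harmonic_constant mP irrP revP Pg.
have nuE x : nu ord0 x = g ord0 ord0 * mu ord0 x.
  by rewrite (gC ord0 x) mxE divfK.
have g1 : g ord0 ord0 = 1.
  rewrite -[RHS]nu1 -[LHS]mulr1 -mu1 mulr_sumr.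
  by apply: eq_bigr => x _; rewrite nuE.
by apply/rowP => x; rewrite nuE g1 mul1r.
Qed.

Lemma uniform_hypergroup_diag {R : realType} {n : nat} {P : 'M[R]_n.+1}
    {m : R} {theta : 'I_n.+1 -> R} {phi : 'I_n.+1 -> 'cV[R]_n.+1}
    {x0 : 'I_n.+1} :
  0 < m -> orthonormal_eigenbasis (const_mx m) P theta phi ->
  (forall k, phi k x0 ord0 != 0) ->
  (forall x y z, 0 <= \sum_k (phi k x ord0 * phi k y ord0 * phi k z ord0)
                             / phi k x0 ord0) ->
  forall x, P x x = P x0 x0.
Proof.
move=> m0 [orth eig _ phi1] phi0 K0.
have orthE j k : \sum_x m * (phi j x ord0 * phi k x ord0) = (j == k)%:R.
  by rewrite -orth; apply: eq_bigr => x _; rewrite mxE.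
pose A : 'M[R]_n.+1 := \matrix_(k, x) phi k x ord0.
(* Orthonormality is the product in the other order; for square matrices it implies this one, the
   completeness relation [dual]. *)
have AtA : A^T *m (m *: A) = 1%:M.
  apply: mulmx1C; apply/matrixP => j k; rewrite !mxE -orthE.
  by apply: eq_bigr => x _; rewrite !mxE mulrA.
have dual x y : \sum_k phi k x ord0 * (m * phi k y ord0) = (x == y)%:R.
  move/matrixP/(_ x y): AtA; rewrite !mxE => <-.
  by apply: eq_bigr => k _; rewrite !mxE.
have PE : P = A^T *m diag_mx (\row_k theta k) *m (m *: A).
  rewrite -[LHS]mulmx1 -AtA mulmxA; congr (_ *m _).
  rewrite mul_mx_diag; apply/matrixP => x k; rewrite [RHS]mxE.
  have /matrixP/(_ x ord0) := eig k; rewrite !mxE mulrC => <-.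
  by apply: eq_bigr => y _; rewrite !mxE.
have Pxx x : P x x = \sum_k theta k * m * phi k x ord0 ^+ 2.
  rewrite {1}PE mul_mx_diag mxE; apply: eq_bigr => k _.
  by rewrite !mxE; ring.
suff sq x k : phi k x ord0 ^+ 2 = phi k x0 ord0 ^+ 2.
  by move=> x; rewrite !Pxx; apply: eq_bigr => k _; rewrite sq.
pose w z := m * \sum_k (phi k x ord0 * phi k x ord0 * phi k z ord0)
                       / phi k x0 ord0.
(* Orthonormality keeps only the term [k = j]. *)
have w_phi j : \sum_z w z * phi j z ord0 = phi j x ord0 ^+ 2 / phi j x0 ord0.
  transitivity (\sum_k phi k x ord0 ^+ 2 / phi k x0 ord0 * (k == j)%:R).
    under [RHS]eq_bigr => i _ do rewrite -orthE mulr_sumr.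
    rewrite exchange_big; apply: eq_bigr => z _.
    rewrite /w mulr_sumr mulr_suml; apply: eq_bigr => i _.
    by field; rewrite phi0.
  rewrite (bigD1 j) //= eqxx mulr1 big1 ?addr0 // => i /negbTE ->.
  by rewrite mulr0.
(* At [z = x0] the denominators cancel, leaving [dual x x]. *)
have wx0 : w x0 = 1.
  rewrite /w mulr_sumr; transitivity ((x == x)%:R : R); last by rewrite eqxx.
  by rewrite -dual; apply: eq_bigr => i _; field; rewrite phi0.
have w1 : \sum_z w z = 1.
  transitivity (\sum_z w z * phi ord0 z ord0).
    by apply: eq_bigr => z _; rewrite phi1 mxE mulr1.
  by rewrite w_phi phi1 !mxE expr1n divr1.
(* [w] is nonnegative by [K0], and [x0] already carries its whole mass. *)
have w0 z : z != x0 -> w z = 0.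
  have : \sum_(z | z != x0) w z = 0.
    by move: w1; rewrite (bigD1 x0) //= wx0 -[RHS]addr0 => /addrI.
  by move/psumr_eq0P; apply => y _; rewrite mulr_ge0 ?K0 // ltW.
have := w_phi k; rewrite (bigD1 x0) //= wx0 mul1r big1 ?addr0; last first.
  by move=> z /w0 ->; rewrite mul0r.
by move=> e; rewrite -[LHS](divfK (phi0 k)) -e expr2.
Qed.

Lemma symmetric_birth_death_diag {R : realType} {N : nat} {P : 'M[R]_N.+1} :
  (2 <= N)%N -> markov_kernel P -> irreducible_kernel P -> birth_death P ->
  (forall x y, P x y = P y x) -> ~ (forall x y, P x x = P y y).
Proof.
move=> hN [P0 P1] irrP bdP symP diagP.
have far (x y : 'I_N.+1) : (1 < `|x - y|)%N -> P x y = 0.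
  move=> xy; apply/le_anti; rewrite P0 andbT leNgt; apply/negP => /bdP.
  by rewrite leqNgt xy.
have v k : (k <= 2)%N -> (inord k : 'I_N.+1) = k :> nat.
  by move=> hk; rewrite inordK //; lia.
pose a : 'I_N.+1 := inord 0; pose b : 'I_N.+1 := inord 1.
pose c : 'I_N.+1 := inord 2.
have [va vb vc] : [/\ a = 0%N :> nat, b = 1%N :> nat & c = 2%N :> nat].
  by rewrite /a /b /c !v.
have neq (x y : 'I_N.+1) : (x != y) = ((x : nat) != y) by [].
have rowa : P a a + P a b = 1.
  rewrite -(P1 a) (bigD1 a) //= (bigD1 b) /= ?neq ?va ?vb //.
  rewrite big1 ?addr0 // => x /andP[]; rewrite !neq va vb => xa xb.
  by apply: far; rewrite va; lia.
have rowb : P b a + P b b + P b c = 1.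
  rewrite -(P1 b) (bigD1 a) //= (bigD1 b) /= ?neq ?va ?vb //.
  rewrite (bigD1 c) /= ?neq ?va ?vb ?vc //.
  rewrite big1 ?addr0 ?addrA // => x /andP[/andP[]]; rewrite !neq va vb vc.
  by move=> xa xb xc; apply: far; rewrite vb; lia.
have bc : P b c = 0.
  move: rowb; rewrite -rowa (diagP b a) (symP b a) [P a b + _]addrC -[RHS]addr0.
  exact: addrI.
(* The indicator of the set of states 0 and 1: a nearest-neighbour edge can cross this cut only
   between [b] and [c], where [P] vanishes, so [f] is constant along edges although it separates [a]
   from [c]. *)
pose f (x : 'I_N.+1) : R := (x <= 1)%N%:R.
have : f a = f c.
  apply: (irreducible_edge_constant P0 irrP) => x y Pxy.
  have /eqP Nxy : P x y != 0 by rewrite gt_eqF.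
  have hxy := bdP _ _ Pxy.
  rewrite /f; congr (_ %:R); congr nat_of_bool.
  apply/idP/idP => h; apply/negPn/negP => h'; apply: Nxy.
    have -> : x = b by apply: val_inj; rewrite /= vb; lia.
    by have -> : y = c by apply: val_inj; rewrite /= vc; lia.
  rewrite symP.
  have -> : y = b by apply: val_inj; rewrite /= vb; lia.
  by have -> : x = c by apply: val_inj; rewrite /= vc; lia.
by rewrite /f va vc => /eqP; rewrite oner_eq0.
Qed.

Lemma convex_potentials0 (R : realType) (N : nat) :
  0 \in @convex_potentials R N.
Proof.
have aff0 t : affine_extension (0 : 'rV[R]_N.+1) t = 0.
  by rewrite /affine_extension !mxE !mulr0 addr0.
by apply/mem_set => t x y _ _; rewrite !aff0 convmm.
Qed.

Theorem theorem1 (R : realType) (N : nat) (hN : (2 <= N)%N) :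
  ~ exists P : 'rV[R]_N.+1 -> 'M[R]_N.+1,
      generalized_metropolis P /\
      (forall U : 'rV[R]_N.+1,
         U \in @convex_potentials R N -> hypergroup_property (P U)).
Proof.
case=> P [[_ metP] hypP].
have [mP irrP bdP invP] := metP _ (convex_potentials0 R N).
have [x0 [mu [revP [theta [phi [basis phi0 K0]]]]]] :=
  hypP _ (convex_potentials0 R N).
(* The hypergroup property supplies its own reversing probability [mu]; uniqueness identifies it
   with [gibbs 0], which is uniform. *)
have muE := reversible_invariant_unique mP irrP revP invP.
have [_ mu0 rev] := revP.
pose m := mu ord0 ord0.
have mu_const : mu = const_mx m.
  by apply/rowP => x; rewrite /m -muE !mxE.
have diagP x : P 0 x x = P 0 x0 x0.
  apply: (uniform_hypergroup_diag (m := m)) phi0 K0 x; first exact: mu0.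
  by rewrite -mu_const; exact: basis.
apply: (symmetric_birth_death_diag hN mP irrP bdP) => x y.
  have := rev x y; rewrite mu_const !mxE => /mulfI; apply.
  by rewrite gt_eqF ?mu0.
by rewrite !diagP.
Qed.
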